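(* Let $G=(V,E)$ be a finite weighted graph with measure $\mu$, let $m_1,m_2\in\mathbb{N}$ with $m_1,m_2\ge 1$, $p,q\ge 2$, $h_1,h_2:V\to(0,\infty)$, let $\mathcal{J}\subset\mathbb{R}$ be a bounded closed interval and $F:V\times\mathbb{R}^2\times\mathcal{J}\to\mathbb{R}$. Assume that $F(x,0,0,w)=0$ for all $w\in\mathcal{J}$, $x\in V$, that $F(x,t,s,w)$ is continuously differentiable in $(t,s,w)\in\mathbb{R}^2\times\mathcal{J}$ for all $x\in V$, and that $$F_t(x,t,s,w)t+F_s(x,t,s,w)s<0\quad\text{for all }x\in V,\ (t,s)\in\mathbb{R}^2\setminus\{(0,0)\},\ w\in\mathcal{J}.$$ Then for every $w\in\mathcal{J}$ the system $$\pounds_{m_1,p}u+h_1(x)|u|^{p-2}u=F_u(x,u,v,w),\qquad \pounds_{m_2,q}v+h_2(x)|v|^{q-2}v=F_v(x,u,v,w),\qquad x\in V,$$ has no nontrivial solutions, i.e. no solution $(u,v)\neq(0,0)$.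
   Context: $G=(V,E)$ is a finite graph ($V$, $E$ finite); each edge $xy\in E$ has weight $\omega_{xy}=\omega_{yx}>0$; $y\sim x$ means $xy\in E$; $\mu:V\to(0,\infty)$ is a measure. $\int_V u\,d\mu=\sum_{x\in V}\mu(x)u(x)$. For $u,v:V\to\mathbb{R}$: $\Delta u(x)=\frac1{\mu(x)}\sum_{y\sim x}\omega_{xy}(u(y)-u(x))$; $\Gamma(u,v)(x)=\frac1{2\mu(x)}\sum_{y\sim x}\omega_{xy}(u(y)-u(x))(v(y)-v(x))$; $|\nabla u|=\sqrt{\Gamma(u,u)}$; $|\nabla^m u|=|\nabla\Delta^{\frac{m-1}2}u|$ if $m$ is odd and $|\Delta^{\frac m2}u|$ if $m$ is even. The operator $\pounds_{m,s}$ is defined by: for all $\phi:V\to\mathbb{R}$, $\int_V(\pounds_{m,s}u)\phi\,d\mu=\int_V|\nabla^mu|^{s-2}\Gamma(\Delta^{\frac{m-1}2}u,\Delta^{\frac{m-1}2}\phi)\,d\mu$ if $m$ is odd, and $=\int_V|\nabla^mu|^{s-2}\Delta^{\frac m2}u\,\Delta^{\frac m2}\phi\,d\mu$ if $m$ is even. $F_t=F_u$ and $F_s=F_v$ are the partial derivatives of $F$ in its second and third arguments. A solution is a pair of functions $u,v:V\to\mathbb{R}$ satisfying both equations at every $x\in V$. *)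

(* Defs.v *)
From HB Require Import structures.
From mathcomp Require Import all_boot all_order all_algebra.
From mathcomp Require Import all_classical all_reals all_analysis.

Set Implicit Arguments.
Unset Strict Implicit.
Unset Printing Implicit Defensive.

Import Order.TTheory GRing.Theory Num.Theory.
Import numFieldNormedType.Exports.

Local Open Scope classical_set_scope.
Local Open Scope ring_scope.

(* Only the values of [weight] on edges matter; connectedness and absence of
   loops are not required (a loop contributes 0 to [laplacian] and [cdc]). *)
Record wgraph (R : realType) (V : finType) := WGraph {
  edge : rel V;
  weight : V -> V -> R;
  meas : V -> R;
  edge_sym : forall x y, edge x y = edge y x;
  weight_sym : forall x y, edge x y -> weight x y = weight y x;
  weight_gt0 : forall x y, edge x y -> 0 < weight x y;
  meas_gt0 : forall x, 0 < meas x
}.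

Section Operators.
Variables (R : realType) (V : finType) (G : wgraph R V).
Implicit Types (u v phi L : V -> R) (m : nat) (s : R).

Definition vint u : R := \sum_(x : V) meas G x * u x.

Definition laplacian u : V -> R := fun x =>
  (meas G x)^-1 * \sum_(y : V | edge G x y) weight G x y * (u y - u x).

(* the gradient form Gamma(u, v) *)
Definition cdc u v : V -> R := fun x =>
  (2 * meas G x)^-1 *
  \sum_(y : V | edge G x y) weight G x y * (u y - u x) * (v y - v x).

Definition grad_norm u : V -> R := fun x => Num.sqrt (cdc u u x).

Definition iter_laplacian (k : nat) u : V -> R := iter k laplacian u.

Definition gradm_norm m u : V -> R := fun x =>
  if odd m then grad_norm (iter_laplacian (m.-1)./2 u) x
  else `|iter_laplacian m./2 u x|.

(* The convention 0 `^ 0 = 1 is used when s = 2. *)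
Definition polylap_form m s u phi : R :=
  if odd m then
    vint (fun x => gradm_norm m u x `^ (s - 2) *
      cdc (iter_laplacian (m.-1)./2 u) (iter_laplacian (m.-1)./2 phi) x)
  else
    vint (fun x => gradm_norm m u x `^ (s - 2) *
      iter_laplacian m./2 u x * iter_laplacian m./2 phi x).

Definition is_polylap m s u L : Prop :=
  forall phi, vint (fun x => L x * phi x) = polylap_form m s u phi.

(* The operator defined by the weak formulation [is_polylap], which determines
   it uniquely: see [polylapP] and [is_polylap_uniq]. *)
Definition polylap m s u : V -> R :=
  xget (fun _ => 0) [set L | is_polylap m s u L].

Lemma is_polylap_uniq m s u L1 L2 :
  is_polylap m s u L1 -> is_polylap m s u L2 -> L1 = L2.
Proof.
move=> h1 h2; apply/funext => x.
have := h1 (fun y => (y == x)%:R); rewrite -h2 /vint.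
rewrite (bigD1 x) //= [X in _ = X](bigD1 x) //= eqxx !mulr1.
rewrite !big1 ?addr0; last 2 first.
- by move=> i /negbTE ->; rewrite !mulr0.
- by move=> i /negbTE ->; rewrite !mulr0.
by move/(mulfI (lt0r_neq0 (meas_gt0 G x))).
Qed.

Lemma laplacian_lin a u v :
  laplacian (fun x => a * u x + v x) =
  (fun x => a * laplacian u x + laplacian v x).
Proof.
apply/funext => x; rewrite /laplacian mulrCA -mulrDr; congr (_ * _).
rewrite mulr_sumr -big_split /=; apply: eq_bigr => y _; rewrite mulrCA -mulrDr; congr (_ * _).
by rewrite mulrBr opprD addrACA.
Qed.

Lemma iter_laplacian_lin k a u v :
  iter_laplacian k (fun x => a * u x + v x) =
  (fun x => a * iter_laplacian k u x + iter_laplacian k v x).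
Proof.
by elim: k => //= k IH; rewrite /iter_laplacian /= -!/(iter_laplacian k _) IH
  laplacian_lin.
Qed.

Lemma cdc_lin u a v1 v2 x :
  cdc u (fun x => a * v1 x + v2 x) x = a * cdc u v1 x + cdc u v2 x.
Proof.
rewrite /cdc mulrCA -mulrDr; congr (_ * _).
rewrite mulr_sumr -big_split /=; apply: eq_bigr => y _; rewrite mulrCA -mulrDr; congr (_ * _).
by rewrite mulrBr opprD addrACA.
Qed.

Lemma vint_lin a u v :
  vint (fun x => a * u x + v x) = a * vint u + vint v.
Proof.
rewrite /vint mulr_sumr -big_split /=; apply: eq_bigr => x _.
by rewrite mulrDr mulrCA.
Qed.

Lemma polylap_form_lin m s u a phi psi :
  polylap_form m s u (fun x => a * phi x + psi x) =
  a * polylap_form m s u phi + polylap_form m s u psi.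
Proof.
rewrite /polylap_form; case: ifP => _; rewrite -vint_lin; congr vint;
  apply/funext => x; rewrite iter_laplacian_lin ?cdc_lin mulrDr;
  congr (_ + _); exact: mulrCA.
Qed.

Lemma polylapP m s u : is_polylap m s u (polylap m s u).
Proof.
rewrite /polylap; case: xgetP => [L _ //|noL]; exfalso.
pose T := polylap_form m s u; pose d x : V -> R := fun y => (y == x)%:R.
apply: (noL (fun x => (meas G x)^-1 * T (d x))) => phi.
have T0 : T (fun=> 0) = 0.
  have := polylap_form_lin m s u 1 (fun=> 0) (fun=> 0).
  rewrite mulr0 addr0 mul1r -/T.
  by rewrite -[LHS]addr0 => /addrI <-.
have Tsum (r : seq V) :
    T (fun y => \sum_(x <- r) phi x * d x y) = \sum_(x <- r) phi x * T (d x).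
  elim: r => [|z r IH].
    by rewrite big_nil -[RHS]T0; congr T; apply/funext => y; rewrite big_nil.
  rewrite big_cons -IH -polylap_form_lin; congr T.
  by apply/funext => y; rewrite big_cons.
transitivity (\sum_x phi x * T (d x)).
  apply: eq_bigr => x _; rewrite -mulrA mulVKf ?lt0r_neq0 ?meas_gt0 //.
  exact: mulrC.
rewrite -Tsum; congr T; apply/funext => y; rewrite (bigD1 y) //= /d eqxx mulr1.
by rewrite big1 ?addr0 // => i; rewrite eq_sym => /negbTE ->; rewrite mulr0.
Qed.

End Operators.

Section Nonlinearity.
Variables (R : realType).
Implicit Type f : R -> R -> R -> R.

Definition partial_t f (t s w : R) : R := derive1 (fun t' => f t' s w) t.
Definition partial_s f (t s w : R) : R := derive1 (fun s' => f t s' w) s.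

(* f is C^1 on R^2 x J (values for w outside J are irrelevant): the partial
   derivatives exist and are continuous on R^2 x J.  The derivative in w is the
   limit of difference quotients over points of J, hence one-sided at the
   endpoints (and no constraint when J is a single point). *)
Definition C1_on_slab (J : set R) f : Prop :=
  let slab := [set z : R * R * R | J z.2] in
  [/\ forall t s w, J w ->
        derivable (fun t' => f t' s w) t 1 /\ derivable (fun s' => f t s' w) s 1,
      {within slab, continuous (fun z => partial_t f z.1.1 z.1.2 z.2)},
      {within slab, continuous (fun z => partial_s f z.1.1 z.1.2 z.2)} &
      exists2 fw : R -> R -> R -> R,
        forall t s w, J w ->
          (f t s w' - f t s w) / (w' - w)
            @[w' --> within (J `\ w) (nbhs w)] --> fw t s w
      & {within slab, continuous (fun z => fw z.1.1 z.1.2 z.2)}].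

End Nonlinearity.

Definition is_solution (R : realType) (V : finType) (G : wgraph R V)
    (m1 m2 : nat) (p q : R) (h1 h2 : V -> R) (F : V -> R -> R -> R -> R)
    (w : R) (u v : V -> R) : Prop :=
  forall x : V,
    polylap G m1 p u x + h1 x * `|u x| `^ (p - 2) * u x
      = partial_t (F x) (u x) (v x) w /\
    polylap G m2 q v x + h2 x * `|v x| `^ (q - 2) * v x
      = partial_s (F x) (u x) (v x) w.

(* Main.v *)
(* Test the two equations with u and v respectively and integrate.  The left-hand
   sides give the nonnegative energies of the poly-Laplacians plus nonnegative
   potential terms, while the sign condition makes the integral of
   F_u u + F_v v negative as soon as (u, v) is nonzero somewhere. *)
Require Import Defs.
From HB Require Import structures.
From mathcomp Require Import all_boot all_order all_algebra.
From mathcomp Require Import all_classical all_reals all_analysis.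

Import Order.TTheory GRing.Theory Num.Theory.
Import numFieldNormedType.Exports.

Local Open Scope classical_set_scope.
Local Open Scope ring_scope.

Section PolyLaplacianEnergy.
Variables (R : realType) (V : finType) (G : wgraph R V).
Implicit Types (u f g : V -> R) (m : nat) (s : R).

Lemma vint_ge0 f : (forall x, 0 <= f x) -> 0 <= vint G f.
Proof. by move=> f0; apply: sumr_ge0 => x _; rewrite mulr_ge0 // ltW ?meas_gt0. Qed.

(** One vertex suffices for strictness because every vertex carries positive measure. *)
Lemma vint_lt0 f (x : V) : (forall y, f y <= 0) -> f x < 0 -> vint G f < 0.
Proof.
move=> f0 fx; rewrite /vint (bigD1 x) //= ltr_wnDr ?pmulr_rlt0 ?meas_gt0 //.
by apply: sumr_le0 => y _; rewrite pmulr_rle0 ?meas_gt0.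
Qed.

Lemma eq_vint f g : f =1 g -> vint G f = vint G g.
Proof. by move=> fg; apply: eq_bigr => x _; rewrite fg. Qed.

Lemma vintD f g : vint G (fun x => f x + g x) = vint G f + vint G g.
Proof. by rewrite /vint -big_split; apply: eq_bigr => x _; rewrite mulrDr. Qed.

Lemma cdc_ge0 u x : 0 <= cdc G u u x.
Proof.
apply: mulr_ge0; first by rewrite invr_ge0 ltW // mulr_gt0 ?meas_gt0.
apply: sumr_ge0 => y xy; rewrite -mulrA mulr_ge0 -?expr2 ?sqr_ge0 //.
exact/ltW/weight_gt0.
Qed.

(** On the diagonal the integrand is a nonnegative power times [cdc] of a function with itself (odd
    [m]) or times a square (even [m]). *)
Lemma polylap_form_ge0 m s u : 0 <= polylap_form G m s u u.
Proof.
rewrite /polylap_form; case: ifP => _; apply: vint_ge0 => x.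
  by rewrite mulr_ge0 ?powR_ge0 ?cdc_ge0.
by rewrite -mulrA mulr_ge0 ?powR_ge0 // -expr2 sqr_ge0.
Qed.

(** The weak formulation [polylapP] tested with [u] itself yields the diagonal energy; the potential
    contributes [f] times a power times the square of [u]. *)
Lemma polylap_potential_energy_ge0 m s u f : (forall x, 0 <= f x) ->
  0 <= vint G (fun x => (polylap G m s u x + f x * `|u x| `^ (s - 2) * u x) * u x).
Proof.
move=> f0; rewrite (eq_vint _ _ (fun x => mulrDl _ _ _)) vintD polylapP addr_ge0 ?polylap_form_ge0 //; apply: vint_ge0 => x.
by rewrite -mulrA -expr2 mulr_ge0 ?sqr_ge0 // mulr_ge0 ?powR_ge0.
Qed.

End PolyLaplacianEnergy.

Theorem theorem6p1 (R : realType) (V : finType) (G : wgraph R V)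
    (m1 m2 : nat) (hm1 : (1 <= m1)%N) (hm2 : (1 <= m2)%N)
    (p q : R) (hp : 2 <= p) (hq : 2 <= q)
    (h1 h2 : V -> R) (h1_gt0 : forall x, 0 < h1 x) (h2_gt0 : forall x, 0 < h2 x)
    (a b : R) (hab : a <= b)
    (F : V -> R -> R -> R -> R)
    (F0 : forall (x : V) (w : R), w \in `[a, b] -> F x 0 0 w = 0)
    (FC1 : forall x, C1_on_slab [set` `[a, b]] (F x))
    (Fneg : forall (x : V) (t s w : R), (t, s) <> (0, 0) -> w \in `[a, b] ->
       partial_t (F x) t s w * t + partial_s (F x) t s w * s < 0) :
  forall w : R, w \in `[a, b] ->
    ~ exists uv : (V -> R) * (V -> R),
        is_solution G m1 m2 p q h1 h2 F w uv.1 uv.2 /\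
        uv <> (fun=> 0, fun=> 0).
Proof.
move=> w wab [[u v] /= [sol nz]].
have [x nzx] : exists x, (u x, v x) <> (0, 0).
  apply: contrapT => /forallNP z; apply: nz.
  by congr pair; apply/funext => x; have /contrapT[] := z x.
pose f y := partial_t (F y) (u y) (v y) w * u y +
            partial_s (F y) (u y) (v y) w * v y.
(* The sign condition excludes the origin, but [f y] is 0 when [u] and [v] both vanish at [y]. *)
have f_le0 y : f y <= 0.
  have [[u0 v0]|nzy] := pselect ((u y, v y) = (0, 0)); last exact/ltW/Fneg.
  by rewrite /f u0 v0 !mulr0 addr0.
have : vint G f < 0 by apply: (@vint_lt0 _ _ G f x) => //; exact: Fneg.
apply/negP; rewrite -leNgt vintD addr_ge0 //.
  (* Multiplied by [u y] and read from right to left, the first equation turns this half of the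
     integral into the energy of [u]. *)
  rewrite -(eq_vint _ _ G _ _ (fun y => congr1 ( *%R^~ (u y)) (sol y).1)).
  by apply: polylap_potential_energy_ge0 => y; exact/ltW.
rewrite -(eq_vint _ _ G _ _ (fun y => congr1 ( *%R^~ (v y)) (sol y).2)).
by apply: polylap_potential_energy_ge0 => y; exact/ltW.
Qed.
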